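(* Fix a mesh size $h>0$. For $\omega_D\in\mathbb{R}$ and $\boldsymbol{\theta}\in T^{\rm high}$ let $$\widetilde{\mathcal S}_D(\omega_D,\boldsymbol\theta)=I-\omega_D\,\widetilde P(\boldsymbol\theta)\,\widetilde M_D(\boldsymbol\theta)^{-1}\,\widetilde{\mathcal L}(\boldsymbol\theta)$$ be the $3\times 3$ error-propagation symbol of the mass-based distributive relaxation ($Q$-DR). Then the optimal smoothing factor is $$\mu_{{\rm opt},D}=\min_{\omega_D\in\mathbb{R}}\ \max_{\boldsymbol\theta\in T^{\rm high}}\ \big|\lambda\big(\widetilde{\mathcal S}_D(\omega_D,\boldsymbol\theta)\big)\big|=\frac13,$$ where $\lambda(\cdot)$ ranges over all eigenvalues of the matrix, and the minimum is uniquely achieved at $\omega_D=\frac34$.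
   Context: Setting: local Fourier analysis of multigrid relaxation for the 2D Stokes equations discretized by the staggered (MAC) finite-difference scheme on a uniform mesh of size $h$. Operators are represented by their symbols (complex matrices depending on $\boldsymbol\theta=(\theta_1,\theta_2)$). High frequencies: $T^{\rm high}=[-\frac{\pi}{2},\frac{3\pi}{2})^2\setminus[-\frac{\pi}{2},\frac{\pi}{2})^2$. $m(\boldsymbol\theta)=\sin^2(\theta_1/2)+\sin^2(\theta_2/2)$, so that the five-point scalar (negative) Laplacian has symbol $4m(\boldsymbol\theta)/h^2$. The bilinear finite element mass stencil $Q$ has symbol $\widetilde Q=\frac{h^2}{9}(2+\cos\theta_1)(2+\cos\theta_2)$, and $m_s(\boldsymbol\theta)=\left(\frac19(2+\cos\theta_1)(2+\cos\theta_2)\right)^{-1}$, i.e. $\widetilde Q = h^2/m_s$. Symbol of the discrete Stokes operator: $$\widetilde{\mathcal L}(\boldsymbol\theta)=\frac1{h^2}\begin{pmatrix}4m&0&i2h\sin\frac{\theta_1}{2}\\0&4m&i2h\sin\frac{\theta_2}{2}\\-i2h\sin\frac{\theta_1}{2}&-i2h\sin\frac{\theta_2}{2}&0\end{pmatrix}.$$ Symbol of the distribution operator: $$\widetilde P(\boldsymbol\theta)=\begin{pmatrix}1&0&\frac{2i}{h}\sin\frac{\theta_1}{2}\\0&1&\frac{2i}{h}\sin\frac{\theta_2}{2}\\0&0&-\frac{4m}{h^2}\end{pmatrix}.$$ Symbol of the block relaxation operator, in which the inverse of the scalar Laplacian is replaced by $Q$ for both velocity components and the pressure: $$\widetilde M_D(\boldsymbol\theta)=\frac1{h^2}\begin{pmatrix}m_s&0&0\\0&m_s&0\\-i2h\sin\frac{\theta_1}{2}&-i2h\sin\frac{\theta_2}{2}&m_s\end{pmatrix}.$$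 *)

(* Defs.v *)
From HB Require Import structures.
From mathcomp Require Import all_boot all_order all_algebra.
From mathcomp Require Import all_classical all_reals all_analysis.
From mathcomp Require Import complex.

Set Implicit Arguments.
Unset Strict Implicit.
Unset Printing Implicit Defensive.

Import Order.TTheory GRing.Theory Num.Theory.
Local Open Scope classical_set_scope.
Local Open Scope ring_scope.
Local Open Scope complex_scope.

Definition is_maximum (R : realType) (A : set R) (x : R) : Prop :=
  A x /\ ubound A x.

Definition is_minimum (R : realType) (A : set R) (x : R) : Prop :=
  A x /\ lbound A x.

Definition T_high (R : realType) : set (R * R) :=
  (`[- (pi / 2), 3 * pi / 2[ `*` `[- (pi / 2), 3 * pi / 2[)
  `\` (`[- (pi / 2), pi / 2[ `*` `[- (pi / 2), pi / 2[).

Section Symbols.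
Context {R : realType}.
Implicit Types (h omega : R) (t : R * R) (S : R * R -> 'M[R[i]]_3).

Definition m_sym t : R := sin (t.1 / 2) ^+ 2 + sin (t.2 / 2) ^+ 2.

(* [h ^+ 2 / ms_sym t] is the symbol of the bilinear finite element mass stencil,
   which approximates the inverse of the Laplacian symbol [4 * m_sym t / h ^+ 2]. *)
Definition ms_sym t : R := (9^-1 * (2 + cos t.1) * (2 + cos t.2))^-1.

Definition mx3 (rows : seq (seq R[i])) : 'M[R[i]]_3 :=
  \matrix_(i < 3, j < 3) nth 0 (nth [::] rows i) j.

Definition L_sym h t : 'M[R[i]]_3 :=
  let m := (m_sym t)%:C in
  let d1 := 'i * (2 * h * sin (t.1 / 2))%:C in
  let d2 := 'i * (2 * h * sin (t.2 / 2))%:C in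
  (h ^- 2)%:C *: mx3 [:: [:: 4 * m;     0;  d1];
                         [::     0; 4 * m;  d2];
                         [::  - d1;  - d2;   0]].

Definition P_sym h t : 'M[R[i]]_3 :=
  mx3 [:: [:: 1; 0; 'i * (2 / h * sin (t.1 / 2))%:C];
          [:: 0; 1; 'i * (2 / h * sin (t.2 / 2))%:C];
          [:: 0; 0; - (4 * m_sym t / h ^+ 2)%:C]].

Definition MD_sym h t : 'M[R[i]]_3 :=
  let ms := (ms_sym t)%:C in
  let d1 := 'i * (2 * h * sin (t.1 / 2))%:C in
  let d2 := 'i * (2 * h * sin (t.2 / 2))%:C in
  (h ^- 2)%:C *: mx3 [:: [::   ms;    0;  0];
                         [::    0;   ms;  0];
                         [:: - d1; - d2; ms]].

(* [invmx] returns its argument on singular matrices; this case does not occur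
   here, see [MD_sym_unit]. *)
Definition SD_sym h omega t : 'M[R[i]]_3 :=
  1%:M - omega%:C *: (P_sym h t *m invmx (MD_sym h t) *m L_sym h t).

Lemma ms_sym_gt0 t : 0 < ms_sym t.
Proof.
have cos2 (x : R) : 0 < 2 + cos x.
  apply: (@lt_le_trans _ _ (2 + -1)); last by rewrite lerD2l cos_geN1.
  by rewrite subr_gt0 ltr1n.
by rewrite invr_gt0 !mulr_gt0 // invr_gt0 ltr0n.
Qed.

Lemma MD_sym_unit h t : 0 < h -> MD_sym h t \in unitmx.
Proof.
move=> h0; have h2 : (h ^- 2)%:C != 0 :> R[i].
  by rewrite fmorph_eq0 invr_eq0 expf_eq0 /= gt_eqF.
rewrite unitmxE /MD_sym detZ unitfE mulf_neq0 ?expf_neq0 // det_trig.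
  by rewrite !big_ord_recr big_ord0 /= !mxE /= !mulf_neq0 ?oner_eq0 //
     fmorph_eq0 gt_eqF // ms_sym_gt0.
apply/is_trig_mxP => i j; rewrite !mxE.
by case: i => [[|[|[|?]]] ?] //; case: j => [[|[|[|?]]] ?].
Qed.

Definition high_freq_moduli S : set R :=
  [set r | exists2 t, T_high t &
           exists2 lam : R[i], eigenvalue (S t) lam & r = Normc.normc lam].

(* As [sup] is total, whether this is an attained maximum is a separate
   question. *)
Definition smoothing_factor S : R := sup (high_freq_moduli S).

End Symbols.

(* Main.v *)
Require Import Defs.
From HB Require Import structures.
From mathcomp Require Import all_boot all_order all_algebra.
From mathcomp Require Import all_classical all_reals all_analysis.
From mathcomp Require Import complex ring lra.
Import Order.TTheory GRing.Theory Num.Theory.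
Local Open Scope classical_set_scope.
Local Open Scope ring_scope.

(** With [A = 1 - omega P M^-1 L] one has
    [(A - lam) P = P M^-1 ((1 - lam) M - omega L P)], and [L P] is lower triangular
    with constant diagonal [4 m / h^2]. So [1 - omega r] with [r = 4 m / m_s] is
    the only eigenvalue. In terms of [a = cos theta_1] and [b = cos theta_2],
    [r = 2/9 (2 - a - b) (2 + a) (2 + b)], and on the high frequencies, where
    [a <= 0] or [b <= 0], it ranges between [8/9], attained at [(pi, pi)], and
    [16/9], attained at [(pi/2, pi/2)]. The smoothing factor is therefore
    [max(|1 - 8/9 omega|, |1 - 16/9 omega|)], whose minimum [1/3] is attained
    exactly when [1 - 8/9 omega = -(1 - 16/9 omega)], at [omega = 3/4]. *)

(** Determinants in [(S - a) P = P M^-1 N] give [det (S - a) = det N / det M] once [det P] is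
    cancelled, so [invmx M] never has to be computed. *)
Lemma eigenvalue_distributive {F : fieldType} {n : nat} (P M L : 'M[F]_n)
    (w a : F) : P \in unitmx -> M \in unitmx ->
  eigenvalue (1%:M - w *: (P *m invmx M *m L)) a =
  (\det ((1 - a) *: M - w *: (L *m P)) == 0).
Proof.
move=> Pu Mu; set S := 1%:M - _; set N := _ - _.
have SP : (S - a%:M) *m P = P *m invmx M *m N.
  rewrite /S /N mulmxBr -!scalemxAr mulmxKV // !mulmxBl mul1mx mul_scalar_mx.
  by rewrite -scalemxAl !mulmxA scalerBl scale1r addrAC.
rewrite /eigenvalue /eigenspace kermx_eq0 row_free_unit unitmxE unitfE negbK.
have /eqP := congr1 determinant SP.
rewrite !det_mulmx det_inv -mulrA mulrC => /eqP.
have dP : \det P != 0 by rewrite -unitfE -unitmxE.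
have dM : \det M != 0 by rewrite -unitfE -unitmxE.
by move=> /(mulfI dP) ->; rewrite mulf_eq0 invr_eq0 (negbTE dM).
Qed.

(** The [r] of the overview: at high frequencies, the only eigenvalue of [P M^-1 L]. *)
Definition relax_ratio {R : realType} (t : R * R) : R :=
  4 * m_sym t / ms_sym t.

Lemma m_symE {R : realType} (t : R * R) :
  m_sym t = (2 - cos t.1 - cos t.2) / 2.
Proof.
have sin2_half (x : R) : sin (x / 2) ^+ 2 = (1 - cos x) / 2.
  have -> : cos x = cos (x / 2 *+ 2) by rewrite -mulr_natr divfK ?pnatr_eq0.
  by rewrite cos_mulr2n cos2sin2; field.
by rewrite /m_sym !sin2_half; field.
Qed.

Lemma relax_ratioE {R : realType} (t : R * R) :
  relax_ratio t =
  2 / 9 * ((2 - cos t.1 - cos t.2) * (2 + cos t.1) * (2 + cos t.2)).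
Proof. by rewrite /relax_ratio m_symE /ms_sym invrK; field. Qed.

(** The last column of [P] is designed to cancel the gradient entries of [L] and to turn the zero
    pressure block into a Laplacian. *)
Lemma L_sym_mul_P_sym {R : realType} (h : R) (t : R * R) : h != 0 ->
  L_sym h t *m P_sym h t =
  (let m := (m_sym t)%:C in
   let d1 := 'i * (2 * h * sin (t.1 / 2))%:C in
   let d2 := 'i * (2 * h * sin (t.2 / 2))%:C in
   (h ^- 2)%:C *: mx3 [:: [:: 4 * m; 0; 0];
                          [:: 0; 4 * m; 0];
                          [:: - d1; - d2; 4 * m]])%C.
Proof.
move=> h0; have h0C : h%:C%C != 0 :> R[i] by rewrite fmorph_eq0.
have i2 : 'i * 'i = -1 :> R[i] by rewrite -expr2 sqrCi.
apply/matrixP => i j; rewrite /L_sym /P_sym /m_sym.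
case: i => [[|[|[|?]]] ?] //; case: j => [[|[|[|?]]] ?] //;
rewrite !mxE !big_ord_recr big_ord0 /= !mxE /=;
rewrite ?(rmorphM, rmorphD, rmorphN, rmorphXn, fmorphV, rmorph_nat) /=;
first [by ring | by field | idtac].
(* The pressure-pressure entry remains; it needs ['i * 'i = -1], brought in by writing the factor 1
   as [- ('i * 'i)]. *)
by rewrite -[RHS]mul1r -[X in _ = X * _]opprK -i2; field.
Qed.

(** [N] is lower triangular with constant diagonal, so its determinant is a cube with a single root
    in [a]. Positivity of [m_sym t] makes [P] invertible, its last diagonal entry being
    [- 4 m / h^2]. *)
Lemma eigenvalue_SD_sym {R : realType} (h omega : R) (t : R * R) :
    0 < h -> 0 < m_sym t ->
  eigenvalue (SD_sym h omega t) =1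
  pred1 (1 - omega * relax_ratio t)%:C%C.
Proof.
move=> h0 m0 a; have hN0 : h != 0 by rewrite gt_eqF.
have Mu := MD_sym_unit t h0; have ms0 := ms_sym_gt0 t.
set N := (1 - a) *: MD_sym h t - omega%:C%C *: (L_sym h t *m P_sym h t).
have detN : \det N = ((h ^- 2)%:C%C *
    ((1 - a) * (ms_sym t)%:C%C - omega%:C%C * (4 * (m_sym t)%:C%C))) ^+ 3.
  rewrite /N L_sym_mul_P_sym // /MD_sym det_trig.
    by rewrite !big_ord_recr big_ord0 /= !mxE /=; ring.
  apply/is_trig_mxP => i j; rewrite !mxE.
  by case: i => [[|[|[|?]]] ?] //; case: j => [[|[|[|?]]] ?] //= _; ring.
have detP : \det (P_sym h t) != 0.
  rewrite -det_tr det_trig; last first.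
    apply/is_trig_mxP => i j; rewrite !mxE.
    by case: i => [[|[|[|?]]] ?] //; case: j => [[|[|[|?]]] ?].
  rewrite !big_ord_recr big_ord0 /= !mxE /= !mulr1 mul1r oppr_eq0 fmorph_eq0.
  by rewrite gt_eqF // divr_gt0 ?exprn_gt0 // mulr_gt0 // ltr0n.
rewrite /= eigenvalue_distributive // ?unitmxE ?unitfE //.
rewrite -/N detN expf_eq0 /= mulf_eq0 fmorph_eq0 invr_eq0 expf_eq0 /=.
rewrite (negbTE hN0) /=.
have msC : (ms_sym t)%:C%C != 0 :> R[i] by rewrite fmorph_eq0 gt_eqF.
have -> : (1 - omega * relax_ratio t)%:C%C =
    1 - omega%:C%C * (4 * (m_sym t)%:C%C / (ms_sym t)%:C%C) :> R[i].
  by rewrite rmorphB rmorph1 !rmorphM fmorphV rmorph_nat.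
move: (ms_sym t)%:C%C msC => c c0.
apply/eqP/eqP => [E|->]; last by field.
have -> : omega%:C%C * (4 * (m_sym t)%:C%C / c) =
    omega%:C%C * (4 * (m_sym t)%:C%C) / c by rewrite !mulrA.
by rewrite -(subr0_eq E) mulfK // opprB addrC subrK.
Qed.

Lemma cos_le0_high {R : realType} (x : R) :
  pi / 2 <= x -> x < 3 * pi / 2 -> cos x <= 0.
Proof.
move=> x1 x2; rewrite -[x](subrK pi) cosDpi oppr_le0 cos_ge0_pihalf //.
by apply/andP; split; lra.
Qed.

(** One coordinate lies outside the low range, hence in [[pi/2, 3 pi/2[]. The bounds below use the
    high frequencies only through this fact. *)
Lemma T_high_cos {R : realType} (t : R * R) :
  T_high t -> (cos t.1 <= 0) || (cos t.2 <= 0).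
Proof.
case: t => x y [[/=]]; rewrite !in_itv /= => /andP[x1 x2] /andP[y1 y2] nlow.
case: (ltP x (pi / 2)) => [x3|x3]; last by rewrite (cos_le0_high _ x3).
case: (ltP y (pi / 2)) => [y3|y3]; last by rewrite (cos_le0_high _ y3) ?orbT.
by case: nlow; rewrite x1 x3 y1 y3.
Qed.

Lemma T_high_diag {R : realType} (x : R) :
  pi / 2 <= x < 3 * pi / 2 -> T_high (x, x).
Proof.
move=> /andP[x1 x2]; have pi0 := pi_gt0 R.
have x3 : - (pi / 2) <= x by lra.
split; first by split; rewrite /= in_itv /= x3 x2.
by case; rewrite /= in_itv /= ltNge x1 andbF.
Qed.

(* The right-hand side is concave in [a], hence minimal at [a = -1] or [a = 0]. *)
Lemma high_cubic_ge {R : realFieldType} (a b : R) :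
    -1 <= a <= 0 -> -1 <= b <= 1 ->
  4 <= (2 - a - b) * (2 + a) * (2 + b).
Proof.
move=> /andP[a1 a2] /andP[b1 b2].
(* The excess over 4 is the linear interpolation in [a] of its values at -1 and 0, plus the
   concavity term [(2 + b) (a + 1) (- a)]. *)
have -> : (2 - a - b) * (2 + a) * (2 + b) = 4 +
   ((2 + b) * ((a + 1) * - a) + - a * ((1 + b) * (2 - b)) +
    (1 + a) * (2 + (1 + b) * (1 - b) * 2)) by ring.
rewrite lerDl; have ? : 0 <= (1 + b) * (1 - b) by apply: mulr_ge0; lra.
by rewrite !addr_ge0 // !mulr_ge0 //; lra.
Qed.

Lemma high_cubic_le {R : realFieldType} (a b : R) :
    -1 <= a <= 1 -> -1 <= b <= 1 ->
  (2 - a - b) * (2 + a) * (2 + b) <= 8.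
Proof.
move=> /andP[a1 a2] /andP[b1 b2]; pose s := (4 + a + b) / 2.
(* AM-GM, with [s] the mean of [2 + a] and [2 + b]. *)
have -> : (2 - a - b) * (2 + a) * (2 + b) =
    8 - 2 * (s - 2) ^+ 2 * (s + 1) - (6 - 2 * s) * ((a - b) / 2) ^+ 2.
  by rewrite /s; field.
(* This term is [8 - (6 - 2 s) s^2], with a double root at the maximizer [s = 2]. *)
have ? : 0 <= 2 * (s - 2) ^+ 2 * (s + 1).
  by apply: mulr_ge0; [apply: mulr_ge0; rewrite ?sqr_ge0|rewrite /s; lra].
have ? : 0 <= (6 - 2 * s) * ((a - b) / 2) ^+ 2.
  by rewrite mulr_ge0 ?sqr_ge0 // /s; lra.
lra.
Qed.

Lemma T_high_relax_ratio {R : realType} (t : R * R) :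
  T_high t -> 8 / 9 <= relax_ratio t <= 16 / 9.
Proof.
move=> /T_high_cos tH; rewrite relax_ratioE.
have := cos_geN1 t.1; have := cos_le1 t.1.
have := cos_geN1 t.2; have := cos_le1 t.2.
move: (cos t.1) (cos t.2) tH => a b ab b2 b1 a2 a1.
have lo : 4 <= (2 - a - b) * (2 + a) * (2 + b).
  case/orP: ab => ab; first by rewrite high_cubic_ge // ?a1 ?b1.
  have := @high_cubic_ge _ b a; rewrite b1 ab a1 a2 => /(_ isT isT).
  by congr (_ <= _); ring.
have hi : (2 - a - b) * (2 + a) * (2 + b) <= 8.
  by rewrite high_cubic_le // ?a1 ?b1.
by apply/andP; split; lra.
Qed.

Lemma T_high_m_sym_gt0 {R : realType} (t : R * R) : T_high t -> 0 < m_sym t.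
Proof.
move=> /T_high_cos tH; rewrite m_symE.
have := cos_le1 t.1; have := cos_le1 t.2.
by case/orP: tH => ? ? ?; lra.
Qed.

Lemma high_freq_moduli_SD_sym {R : realType} {h : R} (omega : R) : 0 < h ->
  high_freq_moduli (SD_sym h omega) =
  [set `|1 - omega * relax_ratio t| | t in @T_high R].
Proof.
move=> h0; apply/seteqP; split => r /=.
  case=> t tH [lam]; rewrite eigenvalue_SD_sym ?T_high_m_sym_gt0 // => /eqP ->.
  by move=> ->; exists t => //; rewrite /= expr0n addr0 sqrtr_sqr.
case=> t tH <-; exists t => //; exists (1 - omega * relax_ratio t)%:C%C.
  by rewrite eigenvalue_SD_sym ?T_high_m_sym_gt0 //=.
by rewrite /= expr0n addr0 sqrtr_sqr.
Qed.

(** [|1 - omega r|] is convex in [r], so its maximum over [[8/9, 16/9]] is at an endpoint, and both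
    endpoints are values of [relax_ratio]. *)
Lemma maximum_high_freq_moduli {R : realType} {h : R} (omega : R) : 0 < h ->
  is_maximum (high_freq_moduli (SD_sym h omega))
    (Num.max `|1 - omega * (8 / 9)| `|1 - omega * (16 / 9)|).
Proof.
move=> h0; have pi0 := pi_gt0 R; rewrite high_freq_moduli_SD_sym //; split.
  have [_|_] := leP `|1 - omega * (8 / 9)| `|1 - omega * (16 / 9)|.
    exists (pi / 2, pi / 2); first by apply: T_high_diag; apply/andP; split; lra.
    by rewrite relax_ratioE /= cos_pihalf; congr (`|1 - omega * _|); field.
  exists (pi, pi); first by apply: T_high_diag; apply/andP; split; lra.
  by rewrite relax_ratioE /= cospi; congr (`|1 - omega * _|); field.
move=> _ [t /T_high_relax_ratio /andP[r1 r2] <-].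
move: (relax_ratio t) r1 r2 => r r1 r2.
rewrite le_max; case: (lerP 0 omega) => w0.
- have ? : omega * (8 / 9) <= omega * r by rewrite ler_wpM2l.
  have ? : omega * r <= omega * (16 / 9) by rewrite ler_wpM2l.
  apply/orP; case: (ger0P (1 - omega * r)) => _; [left|right].
    by rewrite ler_normr; apply/orP; left; lra.
  by rewrite ler_normr; apply/orP; right; lra.
(* For negative [omega], [1 - omega r] is positive and increasing in [r], so the endpoint [16/9]
   dominates. *)
- have ? : omega * (16 / 9) <= omega * r by rewrite ler_wnM2l // ltW.
  apply/orP; right; rewrite ler_normr; apply/orP; left.
  by rewrite ger0_norm; nra.
Qed.

Lemma smoothing_factor_SD_sym {R : realType} {h : R} (omega : R) : 0 < h ->
  smoothing_factor (SD_sym h omega) =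
  Num.max `|1 - omega * (8 / 9)| `|1 - omega * (16 / 9)|.
Proof.
move=> h0; have [max_in max_ub] := maximum_high_freq_moduli omega h0.
apply/eqP; rewrite eq_le; apply/andP; split.
  by apply: ge_sup => //; eexists; exact: max_in.
by apply: ub_le_sup => //; eexists; exact: max_ub.
Qed.

(** [1 - 8/9 omega <= 1/3] forces [omega >= 3/4], and [16/9 omega - 1 <= 1/3] forces [omega <= 3/4].
    This yields both minimality and uniqueness. *)
Lemma endpoint_moduli_le_third {R : realFieldType} (omega : R) :
  Num.max `|1 - omega * (8 / 9)| `|1 - omega * (16 / 9)| <= 1 / 3 ->
  omega = 3 / 4.
Proof. by rewrite ge_max !ler_norml => /andP[/andP[? ?] /andP[? ?]]; lra. Qed.

Lemma endpoint_moduli_opt {R : realFieldType} :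
  Num.max `|1 - 3 / 4 * (8 / 9)| `|1 - 3 / 4 * (16 / 9)| = 1 / 3 :> R.
Proof.
rewrite ger0_norm; last by lra.
rewrite ler0_norm; last by lra.
by rewrite max_l; lra.
Qed.

Theorem theorem3p1 (R : realType) (h : R) (h_gt0 : 0 < h) :
  [/\ (forall omega : R,
         is_maximum (high_freq_moduli (SD_sym h omega))
                    (smoothing_factor (SD_sym h omega))),
      is_minimum [set smoothing_factor (SD_sym h omega) | omega in [set: R]]
                 (1 / 3)
    & forall omega : R,
        smoothing_factor (SD_sym h omega) = 1 / 3 <-> omega = 3 / 4].
Proof.
have sfE omega := smoothing_factor_SD_sym omega h_gt0.
split=> [omega||omega].
- by rewrite sfE; exact: maximum_high_freq_moduli.
- split; first by exists (3 / 4) => //; rewrite sfE endpoint_moduli_opt.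
  (* A value below [1/3] would force [omega = 3/4], where the value is exactly [1/3]. *)
  move=> _ [omega _ <-]; rewrite sfE leNgt; apply/negP => lt3.
  have omegaE := endpoint_moduli_le_third _ (ltW lt3).
  by move: lt3; rewrite omegaE endpoint_moduli_opt ltxx.
- rewrite sfE; split=> [E|->]; last exact: endpoint_moduli_opt.
  by apply: endpoint_moduli_le_third; rewrite E.
Qed.
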